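(* Let $G$ be a triangle-free finite simple graph. Define $$\sigma(G):=\max\{\nu(G[V(M)]-M): M \text{ is a matching in } G\}.$$ Then $$\tau_{K_3}(G)=1 \iff \sigma(G)\ge 2.$$
   Context: All graphs are finite and simple. A matching is a set of pairwise vertex-disjoint edges; $V(M)$ denotes the set of endpoints of the edges of $M$; $G[V(M)]-M$ is the subgraph induced by $V(M)$ with the edges of $M$ deleted; $\nu(\cdot)$ denotes the matching number (maximum size of a matching). Degree-preserving Builder--Chooser game started from a graph $G_0$: it is played in rounds $t=1,2,\dots$. In round $t$ the current graph is $G_{t-1}=(V,E)$. (i) Builder chooses a matching $M\subseteq E$ and forms the intermediate graph $G^+$ by deleting the edges of $M$, adding a new vertex $w$, and joining $w$ to every vertex of $V(M)$ (a DPG step). (ii) Builder chooses a partition of $E(G^+)$ into two disjoint sets $E^{(0)}\sqcup E^{(1)}$. (iii) Chooser selects $i\in\{0,1\}$, and $G_t:=(V(G^+),E^{(i)})$. For graphs $H$ and $G_0$, the forcing time $\tau_H(G_0)$ is the least $T\ge 0$ such that Builder has a strategy in the game started from $G_0$ guaranteeing that $G_t$ contains $H$ as a (not necessarily induced) subgraph for some $0\le t\le T$; $\tau_H(G_0)=\infty$ if there is no such $T$, i.e. if Chooser can avoid $H$ forever. *)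

(* Defs.v *)
From mathcomp Require Import all_boot.
From mathcomp Require Import boolp.

Set Implicit Arguments.
Unset Strict Implicit.
Unset Printing Implicit Defensive.

(* An edge of a finite simple graph is the two-element set of its endpoints. *)
Record graph := Graph {
  vertex :> finType;
  edges : {set {set vertex}};
  edges_card2 : [forall e in edges, #|e| == 2]
}.

Lemma complete_subproof n :
  [forall e in [set e : {set 'I_n} | #|e| == 2], #|e| == 2].
Proof. by apply/forall_inP => e; rewrite inE. Qed.

Definition complete n : graph := Graph (complete_subproof n).

Definition contains (H G : graph) : Prop :=
  exists2 f : H -> G, injective f &
    forall e : {set H}, e \in edges H -> f @: e \in edges G.

Definition triangle_free (G : graph) : Prop := ~ contains (complete 3) G.

(* Edges are nonempty, so trivIset says that distinct edges are disjoint.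
   V(M) is cover M. *)
Definition matching (G : graph) (M : {set {set G}}) : bool :=
  (M \subset edges G) && trivIset M.

Definition matching_number (G : graph) : nat :=
  \max_(M : {set {set G}} | matching M) #|M|.

Lemma del_edges_subproof (G : graph) (F : {set {set G}}) :
  [forall e in edges G :\: F, #|e| == 2].
Proof.
apply/forall_inP => e; rewrite inE => /andP[_].
exact: (forall_inP (edges_card2 G)).
Qed.

Definition del_edges (G : graph) (F : {set {set G}}) : graph :=
  Graph (del_edges_subproof F).

Lemma induced_subproof (G : graph) (A : {set G}) :
  [forall e in [set e : {set {x : G | x \in A}} | val @: e \in edges G],
    #|e| == 2].
Proof.
apply/forall_inP => e; rewrite inE => he.
by rewrite -(card_imset _ val_inj); apply: (forall_inP (edges_card2 G)).
Qed.

Definition induced (G : graph) (A : {set G}) : graph :=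
  Graph (induced_subproof A).

(* G[V(M)] - M and (G - M)[V(M)] are the same graph; the second form keeps the
   edges of M as sets of vertices of G. *)
Definition sigma (G : graph) : nat :=
  \max_(M : {set {set G}} | matching M)
    matching_number (@induced (del_edges M) (cover M)).

Lemma dpg_subproof (G : graph) (M : {set {set G}}) :
  [forall e in [set Some @: (e : {set G}) | e in edges (del_edges M)]
               :|: [set [set None; Some v] | v in cover M], #|e| == 2].
Proof.
apply/forall_inP => e; rewrite inE => /orP[] /imsetP[x hx ->].
  rewrite card_imset; last exact: Some_inj.
  exact: (forall_inP (edges_card2 (del_edges M))).
by rewrite cards2.
Qed.

(* The new vertex w is None. *)
Definition dpg (G : graph) (M : {set {set G}}) : graph :=
  Graph (dpg_subproof M).

(* E^(0) is part false and E^(1) is part true; either may be empty. *)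
Record move (G : graph) := Move {
  deleted : {set {set G}};
  deleted_matching : matching deleted;
  part : bool -> {set {set dpg deleted}};
  part_cover : part false :|: part true = edges (dpg deleted);
  part_disjoint : [disjoint part false & part true]
}.

Lemma outcome_subproof (G : graph) (m : move G) (i : bool) :
  [forall e in part m i, #|e| == 2].
Proof.
apply/forall_inP => e he; apply: (forall_inP (edges_card2 (dpg (deleted m)))).
by rewrite -part_cover inE; case: i he => ->; rewrite ?orbT.
Qed.

Definition outcome (G : graph) (m : move G) (i : bool) : graph :=
  Graph (outcome_subproof m i).

(* Builder's move depends on Chooser's selections so far and on the current
   graph; together with the initial graph and the strategy itself, the former
   determine the entire history of the play. *)
Definition strategy := seq bool -> forall G : graph, move G.

(* Builder being deterministic, Chooser's behaviour in a play amounts to the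
   sequence c of selections; c t is the selection made in round t + 1. *)
Fixpoint play (s : strategy) (G0 : graph) (c : nat -> bool) (t : nat) : graph :=
  if t is t'.+1 then outcome (s (mkseq c t') (play s G0 c t')) (c t') else G0.

Definition can_force (H G0 : graph) (T : nat) : Prop :=
  exists s : strategy, forall c : nat -> bool,
    exists2 t, t <= T & contains H (play s G0 c t).

(* None stands for infinity. *)
Definition forcing_time (H G0 : graph) : option nat :=
  if pselect (exists T, `[< can_force H G0 T >]) is left ex
  then Some (ex_minn ex) else None.

(* Main.v *)
Require Import Defs.
From mathcomp Require Import all_boot.
From mathcomp Require Import boolp.

(** The graph [G] being triangle-free, every triangle of [dpg M] consists of the
    new vertex [w] and an edge of [G - M] inside [V(M)].  Two such triangles are
    edge-disjoint exactly when the two edges of [G - M] are vertex-disjoint,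
    because a common endpoint [v] amounts to the common edge [wv].  Builder wins
    in one round iff both parts of some partition contain a triangle, that is,
    iff some [dpg M] contains two edge-disjoint triangles. *)

Set Implicit Arguments.
Unset Strict Implicit.
Unset Printing Implicit Defensive.

(** The strict inequality makes this hold over an empty range as well: the maximum is then [0] and
    exceeds no [n]. *)
Lemma ltn_bigmaxP (I : finType) (P : pred I) (F : I -> nat) n :
  n < \max_(i | P i) F i <-> exists2 i, P i & n < F i.
Proof.
split=> [|[i Pi ltnF]]; last by apply: leq_trans ltnF _; exact: leq_bigmax_cond.
rewrite ltnNge => /negP lemax.
have /existsNP[i /not_implyP[Pi /negP]] : ~ forall i, P i -> F i <= n.
  by move/bigmax_leqP.
by rewrite -ltnNge; exists i.
Qed.

Lemma edge_card (G : graph) (e : {set G}) : e \in edges G -> #|e| = 2.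
Proof. by move=> eG; apply/eqP/(forall_inP (edges_card2 G)). Qed.

Lemma edge_neq (G : graph) (x y : G) : [set x; y] \in edges G -> x != y.
Proof. by move/edge_card; rewrite cards2; case: eqP. Qed.

Lemma matching_number_gt1 (G : graph) :
  1 < matching_number G <->
  exists e1 e2 : {set G},
    [/\ e1 \in edges G, e2 \in edges G & [disjoint e1 & e2]].
Proof.
rewrite ltn_bigmaxP; split=> [[N /andP[NG tN]]|[e1 [e2 [e1G e2G dis]]]].
  move=> /card_gt1P[e1 [e2 [e1N e2N ne]]]; exists e1, e2.
  by split; [exact: (subsetP NG)..|exact: (trivIsetP tN)].
have ne : e1 != e2.
  apply: contraTneq dis => <-; rewrite -setI_eq0 setIid -card_gt0.
  by rewrite edge_card.
exists [set e1; e2]; last by rewrite cards2 ne.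
apply/andP; split; first by rewrite subUset !sub1set e1G.
apply/trivIsetP => A B /set2P[]-> /set2P[]->; rewrite ?eqxx // => _.
by rewrite disjoint_sym.
Qed.

(** Image and preimage under [val] carry edges between the subtype and [G], so that later arguments
    stay in [G]. *)
Lemma matching_number_induced_gt1 (G : graph) (A : {set G}) :
  1 < matching_number (induced A) <->
  exists e1 e2 : {set G},
    [/\ e1 \in edges G, e2 \in edges G, e1 \subset A, e2 \subset A
      & [disjoint e1 & e2]].
Proof.
have imval (e : {set {x | x \in A}}) : val @: e \subset A.
  by apply/subsetP => _ /imsetP[x _ ->]; exact: valP.
have preval (e : {set G}) : e \subset A ->
    val @: [set x : {x | x \in A} | val x \in e] = e.
  move=> eA; apply/setP => x; apply/imsetP/idP => [[y + ->]|xe].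
    by rewrite inE.
  by exists (Sub x (subsetP eA x xe)); rewrite ?inE SubK.
rewrite matching_number_gt1; split=> [[e1 [e2 []]]|[e1 [e2 [e1G e2G s1 s2 dis]]]].
  rewrite !inE => e1G e2G dis; exists (val @: e1), (val @: e2); split=> //.
  by rewrite imset_disjoint //; exact: val_inj.
exists [set x | val x \in e1], [set x | val x \in e2].
rewrite !inE !preval //; split=> //.
rewrite -setI_eq0; apply/eqP/setP => x; rewrite !inE.
by apply/negP => /andP[x1]; rewrite (disjointFr dis x1).
Qed.

Lemma sigma_gt1 (G : graph) :
  1 < sigma G <->
  exists M : {set {set G}}, matching M /\
    exists e1 e2 : {set G},
      [/\ e1 \in edges G :\: M, e2 \in edges G :\: M, e1 \subset cover M,
          e2 \subset cover M & [disjoint e1 & e2]].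
Proof.
rewrite ltn_bigmaxP; split=> [[M mM /matching_number_induced_gt1]|[M [mM ?]]].
  by exists M.
by exists M => //; apply/matching_number_induced_gt1.
Qed.

(** Injectivity comes for free: an edge has two elements, so the three edges force [x], [y], [z] to
    be distinct. *)
Lemma contains_triangle (G : graph) :
  contains (complete 3) G <->
  exists x y z : G,
    [/\ [set x; y] \in edges G, [set x; z] \in edges G
      & [set y; z] \in edges G].
Proof.
split=> [[f _ fG]|[x [y [z [xy xz yz]]]]].
  exists (f (inord 0)), (f (inord 1)), (f (inord 2)).
  have edgef (i j : 'I_3) : i != j -> [set f i; f j] \in edges G.
    by move=> ij; rewrite -!imset_set1 -imsetU; apply: fG; rewrite inE cards2 ij.
  by split; apply: edgef; rewrite -val_eqE /= !inordK.
have uxyz : uniq [:: x; y; z].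
  by rewrite /= !inE negb_or !edge_neq.
have edgef (i j : nat) : i < 3 -> j < 3 -> i != j ->
    [set nth x [:: x; y; z] i; nth x [:: x; y; z] j] \in edges G.
  by case: i => [|[|[|]]] //; case: j => [|[|[|]]] //= _ _ _ //; rewrite setUC.
exists (fun i : 'I_3 => nth x [:: x; y; z] i) => [i j /eqP|e].
  by rewrite nth_uniq // => /eqP/val_inj.
rewrite inE => /cards2P[i [j [ij ->]]].
by rewrite imsetU !imset_set1 edgef // val_eqE.
Qed.

(** The two kinds of edges of [dpg M] do not mix, since only the new ones contain [None]. *)
Lemma dpg_edge_old (G : graph) (M : {set {set G}}) (e : {set G}) :
  (Some @: e \in edges (dpg M)) = (e \in edges G :\: M).
Proof.
rewrite [in LHS]inE mem_imset; last exact: imset_inj Some_inj.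
rewrite orbC; case: imsetP => //= -[v _] /setP/(_ None).
by rewrite !inE eqxx => /imsetP[].
Qed.

Lemma dpg_edge_new (G : graph) (M : {set {set G}}) (v : G) :
  ([set None; Some v] \in edges (dpg M)) = (v \in cover M).
Proof.
rewrite inE; apply/orP/idP => [[]/imsetP[]|vM]; last first.
- by right; apply/imsetP; exists v.
- by move=> u uM /setP/(_ (Some v)); rewrite !inE eqxx => /esym/eqP[->].
by move=> e _ /setP/(_ None); rewrite !inE eqxx => /esym/imsetP[].
Qed.

Lemma imset_Some2 (T : finType) (x y : T) :
  [set Some x; Some y] = Some @: [set x; y].
Proof. by rewrite imsetU !imset_set1. Qed.

Lemma part_edge (G : graph) (m : move G) (i : bool) (e : {set dpg (deleted m)}) :
  e \in part m i -> e \in edges (dpg (deleted m)).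
Proof. by rewrite -part_cover inE; case: i => ->; rewrite ?orbT. Qed.

Lemma triangle_outcome (G : graph) (m : move G) (i : bool) :
  triangle_free G -> contains (complete 3) (outcome m i) ->
  exists a b : G,
    [/\ [set None; Some a] \in part m i, [set None; Some b] \in part m i
      & [set Some a; Some b] \in part m i].
Proof.
move=> hG /contains_triangle[x [y [z [xy xz yz]]]].
have := edge_neq xy; have := edge_neq xz; have := edge_neq yz.
(* Two occurrences of [None] contradict distinctness. The new vertex is thus exactly one of [x],
   [y], [z], or it is absent and the triangle already lies in [G]. *)
case: x y z xy xz yz => [x|] [y|] [z|] //= xy xz yz _ _ _; last first.
- by exists y, z.
- by exists x, z; split=> //; rewrite setUC.
- by exists x, y; split=> //; rewrite setUC.
have old (u v : G) : [set Some u; Some v] \in part m i ->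
    [set u; v] \in edges G.
  by move/part_edge; rewrite imset_Some2 dpg_edge_old => /setDP[].
by case: hG; apply/contains_triangle; exists x, y, z; split; apply: old.
Qed.

Lemma winning_moveP (G : graph) : triangle_free G ->
  (exists m : move G, forall i, contains (complete 3) (outcome m i)) <->
  1 < sigma G.
Proof.
move=> hG; rewrite sigma_gt1; split=> [[m win]|[M [mM]]].
  have [a [b [wa wb ab]]] := triangle_outcome hG (win false).
  have [c [d [wc wd cd]]] := triangle_outcome hG (win true).
  have dis u v : [set None; Some u] \in part m false ->
      [set None; Some v] \in part m true -> u != v.
    move=> uF vT; apply: contraTneq vT => <-.
    by rewrite (disjointFr (part_disjoint m) uF).
  have inM i v : [set None; Some v] \in part m i -> v \in cover (deleted m).
    by move/part_edge; rewrite dpg_edge_new.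
  exists (deleted m); split; first exact: deleted_matching.
  exists [set a; b], [set c; d].
  rewrite -!dpg_edge_old -!imset_Some2 (part_edge ab) (part_edge cd).
  rewrite !subUset !sub1set (inM _ _ wa) (inM _ _ wb) (inM _ _ wc) (inM _ _ wd).
  split=> //; rewrite -setI_eq0; apply/eqP/setP => x; rewrite !inE.
  by apply/negP => /andP[/orP[]/eqP-> /orP[]]; apply/negP; apply: dis.
move=> [e1 [e2 [e1G e2G s1 s2 dis]]].
have /eqP/cards2P[a [b [_ e1E]]] := edge_card (G := del_edges M) e1G.
have /eqP/cards2P[c [d [_ e2E]]] := edge_card (G := del_edges M) e2G.
move: e1G e2G s1 s2 dis; rewrite {}e1E {}e2E.
rewrite -!dpg_edge_old -!imset_Some2 !subUset !sub1set.
rewrite -!dpg_edge_new => ab cd /andP[wa wb] /andP[wc wd] dis.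
(* One part is the triangle on [None], [a], [b], the other is everything else; it remains to see
   that the triangle on [None], [c], [d] avoids [T]. *)
pose T : {set {set dpg M}} :=
  [set [set None; Some a]; [set None; Some b]; [set Some a; Some b]].
have TE : T \subset edges (dpg M) by rewrite !subUset !sub1set wa wb.
have cover_parts : T :|: edges (dpg M) :\: T = edges (dpg M).
  by rewrite -{1}(setIidPr TE) setID.
have disj_parts : [disjoint T & edges (dpg M) :\: T].
  by rewrite disjoints_subset setCD subsetUr.
exists (@Move G M mM (fun i => if i then edges (dpg M) :\: T else T)
          cover_parts disj_parts) => i.
apply/contains_triangle.
(* Each edge of the second triangle contains [Some c] or [Some d], whereas the edges of [T] meet the
   old vertices only in [a] and [b]. *)
have notT u (e : {set dpg M}) : u \in [set c; d] -> Some u \in e -> e \notin T.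
  move=> ucd; apply: contraTN => eT; apply/negP => ue.
  have : Some u \in Some @: [set a; b].
    rewrite -imset_Some2; move: ue eT; rewrite !inE => ue /orP[/orP[]|] /eqP eE.
    - by move: ue; rewrite eE !inE /= => ->.
    - by move: ue; rewrite eE !inE /= => ->; rewrite orbT.
    - by move: ue; rewrite eE !inE.
  by rewrite mem_imset ?(disjointFl dis) //; exact: Some_inj.
case: i => /=; [exists None, (Some c), (Some d)|exists None, (Some a), (Some b)].
  split; apply/setDP; split=> //.
  - by apply: (notT c); rewrite !inE eqxx ?orbT.
  - by apply: (notT d); rewrite !inE eqxx ?orbT.
  - by apply: (notT c); rewrite !inE eqxx ?orbT.
by rewrite !inE !eqxx ?orbT.
Qed.

Lemma matching0 (G : graph) : matching (set0 : {set {set G}}).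
Proof.
by rewrite /matching sub0set; apply/trivIsetP => A B; rewrite inE.
Qed.

Lemma disjoint_set0r (T : finType) (A : {set T}) : [disjoint A & set0].
Proof. by rewrite -setI_eq0 setI0. Qed.

(** A legal move available in every graph, used as filler wherever a strategy must be total but its
    answer is irrelevant. *)
Definition null_move (G : graph) : move G :=
  @Move G set0 (matching0 G) (fun i => if i then set0 else edges (dpg set0))
    (setU0 _) (disjoint_set0r _).

Lemma can_force0 (H G : graph) : can_force H G 0 <-> contains H G.
Proof.
split=> [[s /(_ xpredT)[t]]|HG]; first by rewrite leqn0 => /eqP->.
exists (fun _ => null_move) => c.
by exists 0.
Qed.

Lemma can_force1 (H G : graph) : ~ contains H G ->
  can_force H G 1 <-> exists m : move G, forall i, contains H (outcome m i).
Proof.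
move=> nHG; split=> [[s win]|[m win]].
  (* The opening move of [s] wins: against a Chooser who always selects [i], [H] appears by round 1,
     and not at time 0. *)
  exists (s [::] G) => i; have [[|[|//]] // _] := win (fun=> i).
(* A strategy answers at every graph, but [m] is a move from [G] only. Classical choice therefore
   picks, at each [G'], a winning move if there is one. *)
have wins (G' : graph) : exists m' : move G',
    (exists m : move G', forall i, contains H (outcome m i)) ->
    forall i, contains H (outcome m' i).
  have [[m' ?]|no] :=
      pselect (exists m : move G', forall i, contains H (outcome m i)).
    by exists m'.
  by exists (null_move G').
exists (fun _ G' => projT1 (cid (wins G'))) => c; exists 1 => //=.
by case: cid => m' /=; apply; exists m.
Qed.

Theorem theorem3p1 (G : graph) (hG : triangle_free G) :
  forcing_time (complete 3) G = Some 1 <-> 2 <= sigma G.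
Proof.
rewrite -winning_moveP // -can_force1 // /forcing_time.
case: pselect => [ex|no]; last first.
  by split=> // win; case: no; exists 1; apply/asboolP.
case: ex_minnP => T /asboolP winT minT; split=> [[T1]|win1].
  by rewrite T1 in winT.
(* The least time is then 1, as 0 would mean that [G] itself has a triangle. *)
have : T <= 1 by exact: minT (asboolT win1).
by case: T winT minT => [|[|T]] winT _ //; case: hG; apply/can_force0.
Qed.
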